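(* Let $0\le k\le n$ and let $r$ be an integer. The pullback map $\Phi^*\colon\Lambda^k(T^n)\to\Lambda^k(S^n)$ induced by $\Phi(u)=(u_1^2,\dotsc,u_{n+1}^2)$ restricts to linear isomorphisms (i.e. it is injective on, and maps onto, the indicated spaces) \begin{align*} \mathcal P_r\Lambda^k(T^n)&\xrightarrow{\ \simeq\ }\mathcal P_{2r+k}\Lambda^k_e(S^n),\\ \mathcal P_r^-\Lambda^k(T^n)&\xrightarrow{\ \simeq\ }\mathcal P_{2r+k}^-\Lambda^k_e(S^n),\\ \mathring{\mathcal P}_r\Lambda^k(T^n)&\xrightarrow{\ \simeq\ }\mathcal V_{2r+k}\Lambda^k_e(S^n),\\ \mathring{\mathcal P}_r^-\Lambda^k(T^n)&\xrightarrow{\ \simeq\ }\mathcal V_{2r+k}^-\Lambda^k_e(S^n). \end{align*}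
   Context: Let $n\ge1$. $T^n=\{x\in\mathbb R^{n+1}: x_i\ge0 \text{ for all } i,\ x_1+\dotsb+x_{n+1}=1\}$ and $S^n=\{u\in\mathbb R^{n+1}: u_1^2+\dotsb+u_{n+1}^2=1\}$. $\Lambda^k(M)$ denotes (smooth) differential $k$-forms on $M$, for $M=T^n$ (smooth up to the boundary), $S^n$, or $\mathbb R^{n+1}$; $\alpha_u$ denotes the value of $\alpha$ at $u$, an alternating $k$-tensor on the tangent space of $M$ at $u$. The restriction of a form on $\mathbb R^{n+1}$ to $T^n$ or $S^n$ (or of a form on $T^n$ to a facet) is its pullback under inclusion. $\Phi\colon\mathbb R^{n+1}\to\mathbb R^{n+1}$ is $\Phi(u)=(u_1^2,\dotsc,u_{n+1}^2)$; it maps $S^n$ to $T^n$. $\mathcal P_r\Lambda^k(\mathbb R^{n+1})$ is the space of $k$-forms on $\mathbb R^{n+1}$ whose coefficients are polynomials of degree at most $r$ (it is $\{0\}$ if $r<0$). With the radial vector field $X=\sum_{i=1}^{n+1}x_i\frac{\partial}{\partial x_i}$ and interior product $i_X$, $\mathcal P_r^-\Lambda^k(\mathbb R^{n+1}):=i_X\mathcal P_{r-1}\Lambda^{k+1}(\mathbb R^{n+1})$. For $M=T^n$ or $S^n$, $\mathcal P_r\Lambda^k(M)$ and $\mathcal P_r^-\Lambda^k(M)$ are the spaces of restrictions to $M$ of elements of $\mathcal P_r\Lambda^k(\mathbb R^{n+1})$ and $\mathcal P_r^-\Lambda^k(\mathbb R^{n+1})$. $\mathring{\mathcal P}_r\Lambda^k(T^n)$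 and $\mathring{\mathcal P}_r^-\Lambda^k(T^n)$ are the subspaces of those forms in $\mathcal P_r\Lambda^k(T^n)$ and $\mathcal P_r^-\Lambda^k(T^n)$ whose restriction to $\partial T^n$ vanishes, i.e. whose pullback to each facet $\{x\in T^n:x_i=0\}$ is zero. Let $\Gamma_i=\{u\in\mathbb R^{n+1}:u_i=0\}$ and $\Gamma=\bigcup_{i=1}^{n+1}\Gamma_i$. $\mathcal V_s\Lambda^k(S^n)$ and $\mathcal V_s^-\Lambda^k(S^n)$ (written $\mathcal P$ with a double ring in the paper) are the subspaces of those $\alpha$ in $\mathcal P_s\Lambda^k(S^n)$, respectively $\mathcal P_s^-\Lambda^k(S^n)$, such that $\alpha_u=0$ (as a tensor on $T_uS^n$, on all tangent vectors) for every $u\in S^n\cap\Gamma$. Let $R_i\colon\mathbb R^{n+1}\to\mathbb R^{n+1}$ be the reflection changing the sign of $u_i$. A form $\alpha$ on $S^n$ is even if $R_i^*\alpha=\alpha$ for every $i$. The subscript $e$ (as in $\mathcal P_s\Lambda^k_e(S^n)$, $\mathcal P_s^-\Lambda^k_e(S^n)$, $\mathcal V_s\Lambda^k_e(S^n)$, $\mathcal V_s^-\Lambda^k_e(S^n)$) denotes the subspace of even forms. *)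

(* Defs.v *)
From HB Require Import structures.
From mathcomp Require Import all_boot all_order all_algebra.
From mathcomp Require Import all_classical all_reals all_analysis.
From mathcomp Require mpoly.

(* The notations of mpoly are incompatible with those of all_analysis. *)
Import -(notations) mpoly.

Set Implicit Arguments.
Unset Strict Implicit.
Unset Printing Implicit Defensive.

Import Order.TTheory GRing.Theory Num.Theory.
Import numFieldNormedType.Exports.

Local Open Scope classical_set_scope.
Local Open Scope ring_scope.

(* The ambient space R^{n+1} is ['rV[R]_n.+1]; the coordinates x_1, ..., x_{n+1}
   are indexed by ['I_n.+1].  A k-tuple of vectors (v_1, ..., v_k) is the matrix
   ['M[R]_(k, n.+1)] whose j-th row is v_j. *)

(* A subset of R^{n+1} together with its tangent spaces, as subsets of R^{n+1};
   [tangent M x] is only meaningful for x in [points M]. *)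
Record region (R : realType) (n : nat) := Region {
  points : set 'rV[R]_n.+1 ;
  tangent : 'rV[R]_n.+1 -> set 'rV[R]_n.+1 }.

Definition euclid (R : realType) (n : nat) : region R n :=
  Region setT (fun=> setT).

Definition simplex (R : realType) (n : nat) : region R n :=
  Region [set x | (forall i, 0 <= x 0 i) /\ \sum_i x 0 i = 1]
         (fun=> [set v | \sum_i v 0 i = 0]).

Definition facet (R : realType) (n : nat) (i : 'I_n.+1) : region R n :=
  Region [set x | points (simplex R n) x /\ x 0 i = 0]
         (fun x => [set v | tangent (simplex R n) x v /\ v 0 i = 0]).

Definition sphere (R : realType) (n : nat) : region R n :=
  Region [set u | \sum_i u 0 i ^+ 2 = 1]
         (fun u => [set v | \sum_i u 0 i * v 0 i = 0]).

(* A point of M with k tangent vectors of M at that point. *)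
Record frame (R : realType) (n : nat) (M : region R n) (k : nat) := Frame {
  base : 'rV[R]_n.+1 ;
  vecs : 'M[R]_(k, n.+1) ;
  base_in : points M base ;
  vecs_in : forall j, tangent M base (row j vecs) }.

(* Fields of real-valued functions of k tangent vectors; the differential forms
   are the elements of the sets [forms] below.  The target is R^o so that these
   fields carry the pointwise structure of R-module. *)
Definition tfield (R : realType) (n : nat) (M : region R n) (k : nat) :=
  frame M k -> R^o.

Definition subregion (R : realType) (n : nat) (M M' : region R n) :=
  forall x, points M x ->
    points M' x /\ forall v, tangent M x v -> tangent M' x v.

Definition incl_frame (R : realType) (n : nat) (M M' : region R n)
    (h : subregion M M') (k : nat) (p : frame M k) : frame M' k :=
  Frame (proj1 (h _ (base_in p)))
        (fun j => proj2 (h _ (base_in p)) _ (vecs_in p j)).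

(* Pullback under the inclusion of M in M'. *)
Definition restrict (R : realType) (n : nat) (M M' : region R n)
    (h : subregion M M') (k : nat) (a : tfield M' k) : tfield M k :=
  fun p => a (incl_frame h p).

Lemma sub_euclid (R : realType) (n : nat) (M : region R n) :
  subregion M (euclid R n).
Proof. by []. Qed.

Lemma facet_sub (R : realType) (n : nat) (i : 'I_n.+1) :
  subregion (facet R i) (simplex R n).
Proof. by move=> x [Tx _]; split=> // v []. Qed.

Definition maps_region (R : realType) (n : nat) (M M' : region R n)
    (f : 'rV[R]_n.+1 -> 'rV[R]_n.+1) :=
  forall x, points M x ->
    [/\ differentiable f x, points M' (f x) &
        forall v, tangent M x v -> tangent M' (f x) ('d f x v)].

Lemma push_vecs_in (R : realType) (n : nat) (M M' : region R n)
    (f : 'rV[R]_n.+1 -> 'rV[R]_n.+1) (h : maps_region M M' f) (k : nat)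
    (p : frame M k) (j : 'I_k) :
  tangent M' (f (base p))
    (row j (\matrix_(i < k) 'd f (base p) (row i (vecs p)))).
Proof. by rewrite rowK; case: (h _ (base_in p)) => _ _; apply; exact: vecs_in. Qed.

Definition push_frame (R : realType) (n : nat) (M M' : region R n)
    (f : 'rV[R]_n.+1 -> 'rV[R]_n.+1) (h : maps_region M M' f) (k : nat)
    (p : frame M k) : frame M' k :=
  Frame (let: And3 _ Mfx _ := h _ (base_in p) in Mfx) (push_vecs_in h p).

(* (f^* a)_x (v_1, ..., v_k) = a_{f x} (df_x v_1, ..., df_x v_k) *)
Definition pullback (R : realType) (n : nat) (M M' : region R n)
    (f : 'rV[R]_n.+1 -> 'rV[R]_n.+1) (h : maps_region M M' f) (k : nat)
    (a : tfield M' k) : tfield M k :=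
  fun p => a (push_frame h p).

Definition eframe (R : realType) (n k : nat) (x : 'rV[R]_n.+1)
    (v : 'M[R]_(k, n.+1)) : frame (euclid R n) k :=
  @Frame R n (euclid R n) k x v I (fun=> I).

(* Alternating k-tensors on R^{n+1}, phrased as [determinant_multilinear] and
   [determinant_alternate]. *)
Definition alternating_tensor (R : realType) (n k : nat)
    (t : 'M[R]_(k, n.+1) -> R) :=
  (forall (A B C : 'M[R]_(k, n.+1)) (i0 : 'I_k) (b c : R),
     row i0 A = b *: row i0 B + c *: row i0 C ->
     row' i0 B = row' i0 A -> row' i0 C = row' i0 A ->
     t A = b * t B + c * t C) /\
  (forall (A : 'M[R]_(k, n.+1)) (i1 i2 : 'I_k),
     i1 != i2 -> row i1 A = row i2 A -> t A = 0).

(* The coefficient of dx_{I 0} /\ ... /\ dx_{I (k-1)} is the value on the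
   corresponding basis vectors.  I ranges over all multi-indices and not only
   over the increasing ones: the other coefficients are 0 or differ by a sign. *)
Definition coefficient (R : realType) (n k : nat) (a : tfield (euclid R n) k)
    (I : 'I_k -> 'I_n.+1) : 'rV[R]_n.+1 -> R :=
  fun x => a (eframe x (\matrix_(j < k) delta_mx 0 (I j))).

Definition forms_with (R : realType) (n k : nat) (C : set ('rV[R]_n.+1 -> R)) :
    set (tfield (euclid R n) k) :=
  [set a | (forall x, alternating_tensor (fun v => a (eframe x v))) /\
           forall I, C (coefficient a I)].

Definition smooth_fun (R : realType) (n : nat) (f : 'rV[R]_n.+1 -> R) :=
  forall (s : seq 'rV[R]_n.+1) (x : 'rV[R]_n.+1),
    differentiable (foldr (fun v g y => 'D_v g y) f s) x.

(* Polynomial functions of degree at most r, for r an integer; stated on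
   monomials, so that only the zero function is left when r < 0. *)
Definition poly_fun (R : realType) (n : nat) (r : int) (f : 'rV[R]_n.+1 -> R) :=
  exists2 p : mpoly n.+1 R,
    forall m, m \in msupp p -> (mdeg m)%:Z <= r &
    forall x, f x = meval (fun i => x 0 i) p.

(* Lambda^k(M).  On the simplex, smooth up to the boundary means extending to a
   smooth form on R^{n+1}. *)
Definition forms (R : realType) (n : nat) (M : region R n) (k : nat) :
    set (tfield M k) :=
  restrict (@sub_euclid R n M) (k := k) @` forms_with (@smooth_fun R n).
Arguments forms {R n} M k.

(* Interior product with the radial vector field, whose value at x is x. *)
Definition iX (R : realType) (n k : nat) (a : tfield (euclid R n) k.+1) :
    tfield (euclid R n) k :=
  fun p => a (eframe (base p) (col_mx (base p) (vecs p) : 'M[R]_(1 + k, n.+1))).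

Definition polyforms (R : realType) (n : nat) (M : region R n)
    (r : int) (k : nat) :
    set (tfield M k) :=
  restrict (@sub_euclid R n M) (k := k) @` forms_with (@poly_fun R n r).
Arguments polyforms {R n} M r k.

Definition polyforms_minus (R : realType) (n : nat) (M : region R n)
    (r : int) (k : nat) :
    set (tfield M k) :=
  restrict (@sub_euclid R n M) (k := k) @`
    (@iX R n k @` forms_with (@poly_fun R n (r - 1))).
Arguments polyforms_minus {R n} M r k.

Definition vanishing_trace (R : realType) (n k : nat) :
    set (tfield (simplex R n) k) :=
  [set a | forall i, restrict (@facet_sub R n i) a = 0].
Arguments vanishing_trace : clear implicits.

(* Vanishing on all tangent vectors of the sphere at the points of Gamma. *)
Definition vanishing_on_Gamma (R : realType) (n k : nat) :
    set (tfield (sphere R n) k) :=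
  [set a | forall p, (exists i, base p 0 i = 0) -> a p = 0].
Arguments vanishing_on_Gamma : clear implicits.

Definition Phi (R : realType) (n : nat) (u : 'rV[R]_n.+1) : 'rV[R]_n.+1 :=
  \row_i u 0 i ^+ 2.

Definition reflection (R : realType) (n : nat) (i : 'I_n.+1)
    (u : 'rV[R]_n.+1) : 'rV[R]_n.+1 :=
  \row_j (if j == i then - u 0 j else u 0 j).

Lemma coord_continuous_rV (R : realType) (n : nat) (i : 'I_n.+1) :
  continuous (fun u : 'rV[R]_n.+1 => u 0 i : R).
Proof. by move=> x; exact/differentiable_continuous/differentiable_coord. Qed.

Lemma diff_coord (R : realType) (n : nat) (i : 'I_n.+1) (x v : 'rV[R]_n.+1) :
  'd (fun u : 'rV[R]_n.+1 => u 0 i : R) x v = v 0 i.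
Proof.
have glin : linear (fun u : 'rV[R]_n.+1 => u 0 i : R^o).
  by move=> a u w; rewrite !mxE.
pose g' := GRing.isLinear.Build _ _ _ _ _ glin.
pose g : {linear 'rV[R]_n.+1 -> R^o} := HB.pack (fun u : 'rV[R]_n.+1 => u 0 i : R^o) g'.
by rewrite (@diff_lin _ _ _ g x) //; exact: coord_continuous_rV.
Qed.

Lemma differentiable_rV (R : realType) (n : nat)
    (f : 'rV[R]_n.+1 -> 'rV[R]_n.+1) (x : 'rV[R]_n.+1) :
  (forall i, differentiable (fun u => f u 0 i : R) x) -> differentiable f x.
Proof.
move=> df.
have -> : f = \sum_(i < n.+1) (fun u => f u 0 i *: delta_mx 0 i).
  by apply/funext => u; rewrite fct_sumE; exact: row_sum_delta.
by apply: differentiable_sum => i; exact: differentiableZl.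
Qed.

Lemma diff_rV (R : realType) (n : nat) (f : 'rV[R]_n.+1 -> 'rV[R]_n.+1)
    (x v : 'rV[R]_n.+1) (i : 'I_n.+1) :
  differentiable f x -> 'd f x v 0 i = 'd (fun u => f u 0 i : R) x v.
Proof.
move=> df.
have dc := differentiable_coord (f x) 0 i.
by rewrite (diff_comp df dc) /= diff_coord.
Qed.

Lemma Phi_coord (R : realType) (n : nat) (i : 'I_n.+1) :
  (fun u => @Phi R n u 0 i : R) = (fun u => u 0 i : R) ^+ 2.
Proof. by apply/funext => u; rewrite exprfctE mxE. Qed.

Lemma differentiable_Phi (R : realType) (n : nat) (u : 'rV[R]_n.+1) :
  differentiable (@Phi R n) u.
Proof.
apply: differentiable_rV => i.
rewrite Phi_coord; exact: (differentiableX 1 (differentiable_coord u 0 i)).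
Qed.

Lemma diff_Phi (R : realType) (n : nat) (u v : 'rV[R]_n.+1) :
  'd (@Phi R n) u v = \row_i (2 * u 0 i * v 0 i).
Proof.
apply/rowP => i; rewrite mxE (diff_rV _ _ (differentiable_Phi u)) Phi_coord.
have dc := differentiable_coord u 0 i.
by rewrite (diffX 1 dc) /= diff_coord expr1.
Qed.

Lemma differentiable_reflection (R : realType) (n : nat) (i : 'I_n.+1)
    (u : 'rV[R]_n.+1) :
  differentiable (@reflection R n i) u.
Proof.
apply: differentiable_rV => j.
under eq_fun do rewrite mxE.
case: eqP => _; last exact: differentiable_coord.
exact/differentiableN/differentiable_coord.
Qed.

Lemma diff_reflection (R : realType) (n : nat) (i : 'I_n.+1)
    (u v : 'rV[R]_n.+1) :
  'd (@reflection R n i) u v = reflection i v.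
Proof.
apply/rowP => j; rewrite mxE (diff_rV _ _ (differentiable_reflection i u)).
have dc := differentiable_coord u 0 j.
under eq_fun do rewrite mxE.
case: eqP => _; last exact: diff_coord.
by rewrite (diffN dc) -[LHS]/(- 'd _ _ _) diff_coord.
Qed.

Lemma Phi_map (R : realType) (n : nat) :
  maps_region (sphere R n) (simplex R n) (@Phi R n).
Proof.
move=> u /= Su; split; first exact: differentiable_Phi.
  split=> [i|]; first by rewrite mxE sqr_ge0.
  by rewrite -[RHS]Su; apply: eq_bigr => i _; rewrite mxE.
move=> v uv; rewrite diff_Phi.
transitivity (2 * \sum_i u 0 i * v 0 i); last by rewrite uv mulr0.
by rewrite mulr_sumr; apply: eq_bigr => i _; rewrite mxE mulrA.
Qed.

Lemma reflection_map (R : realType) (n : nat) (i : 'I_n.+1) :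
  maps_region (sphere R n) (sphere R n) (@reflection R n i).
Proof.
move=> u /= Su; split; first exact: differentiable_reflection.
  by rewrite -[RHS]Su; apply: eq_bigr => j _; rewrite mxE; case: eqP; rewrite ?sqrrN.
move=> v uv; rewrite diff_reflection -[RHS]uv.
by apply: eq_bigr => j _; rewrite !mxE; case: eqP; rewrite ?mulrNN.
Qed.

Definition even_forms (R : realType) (n k : nat) : set (tfield (sphere R n) k) :=
  [set a | forall i, pullback (@reflection_map R n i) a = a].
Arguments even_forms : clear implicits.

Definition Phi_pullback (R : realType) (n k : nat) :
    tfield (simplex R n) k -> tfield (sphere R n) k :=
  pullback (@Phi_map R n) (k := k).
Arguments Phi_pullback : clear implicits.

(* Main.v *)
(* A form a on R^{n+1} with coefficients a_I pulls back under Phi to the form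
   with coefficients (prod_j 2 u_{I j}) a_I(u^2), and since Phi maps half of the
   radial field to the radial field, pullback commutes with i_X up to a factor 2.
   Conversely, averaging over the reflections R_i makes any polynomial
   representative of an even form on the sphere invariant under every R_i as a
   form on R^{n+1}, without changing its restriction.  The coefficient b_I of an
   invariant form has the parity of prod_j u_{I j} in each variable, hence is
   (prod_j 2 u_{I j}) q_I(u^2), and the q_I are the coefficients of a preimage;
   they are alternating in I because they are so on the open positive orthant.
   Injectivity, and the equivalence of the two boundary conditions, hold since
   d Phi is onto the tangent space of the open face of the simplex that contains
   the image point, and a polynomial form is determined by its values on the
   interior of the simplex or of a facet. *)

From mathcomp Require Import all_boot all_order all_algebra.
From mathcomp Require Import all_classical all_reals all_analysis.
From mathcomp Require Import ring lra zify.
From mathcomp Require mpoly.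
Require Import Defs.

Import -(notations) mpoly.

Set Implicit Arguments.
Unset Strict Implicit.
Unset Printing Implicit Defensive.

Import Order.TTheory GRing.Theory Num.Theory.
Import numFieldNormedType.Exports.

Local Open Scope classical_set_scope.
Local Open Scope ring_scope.

(** * Multilinear functions of the rows of a matrix *)

Section Multilinear.
Variables (R : realType) (n k : nat).
Implicit Types (A : 'M[R]_(k, n.+1)) (t : 'M[R]_(k, n.+1) -> R).

Definition multilinear t :=
  forall A B C (i0 : 'I_k) (b c : R),
    row i0 A = b *: row i0 B + c *: row i0 C ->
    row' i0 B = row' i0 A -> row' i0 C = row' i0 A ->
    t A = b * t B + c * t C.

Definition setrow (i : 'I_k) (w : 'rV[R]_n.+1) A : 'M[R]_(k, n.+1) :=
  \matrix_j (if j == i then w else row j A).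

Lemma row_setrow i w A : row i (setrow i w A) = w.
Proof. by rewrite rowK eqxx. Qed.

Lemma setrow_id i A : setrow i (row i A) A = A.
Proof. by apply/row_matrixP => j; rewrite rowK; case: eqP => // ->. Qed.

Lemma row'_setrow i w A : row' i (setrow i w A) = row' i A.
Proof. by apply/matrixP => j l; rewrite !mxE eq_sym (negPf (neq_lift i j)) mxE. Qed.

Lemma row'_entry i0 A B j l : row' i0 B = row' i0 A -> j != i0 -> B j l = A j l.
Proof.
move=> /matrixP e; case: (unliftP i0 j) => [j' ->|->]; last by rewrite eqxx.
by have := e j' l; rewrite !mxE.
Qed.

Lemma multilinear_setrow t i b c w w' A : multilinear t ->
  t (setrow i (b *: w + c *: w') A) = b * t (setrow i w A) + c * t (setrow i w' A).
Proof.
by move=> h; apply: (h _ _ _ i); rewrite ?row_setrow ?row'_setrow.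
Qed.

Lemma multilinear_setrowZ t i b w A : multilinear t ->
  t (setrow i (b *: w) A) = b * t (setrow i w A).
Proof.
move=> h; have := multilinear_setrow i b 0 w w A h.
by rewrite scale0r addr0 mul0r addr0.
Qed.

Lemma multilinear_setrow_sum t i (I : finType) (c : I -> R) w A : multilinear t ->
  t (setrow i (\sum_l c l *: w l) A) = \sum_l c l * t (setrow i (w l) A).
Proof.
move=> h; elim/big_rec2: _ => [|l x y _ e].
  by rewrite -(scale0r (0 : 'rV_n.+1)) multilinear_setrowZ // mul0r.
by rewrite -[y in LHS](scale1r y) multilinear_setrow // mul1r e.
Qed.

(** Rows are scaled one at a time, by induction on the list of the scaled ones. *)
Lemma multilinear_scale t (c : 'I_k -> R) A : multilinear t ->
  t (\matrix_j (c j *: row j A)) = (\prod_j c j) * t A.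
Proof.
move=> h.
suff H s : uniq s -> t (\matrix_j (if j \in s then c j *: row j A else row j A)) =
    (\prod_(j <- s) c j) * t A.
  rewrite -(H (index_enum 'I_k)) ?index_enum_uniq //; congr t.
  by apply/row_matrixP => j; rewrite !rowK mem_index_enum.
elim: s => [_|i s IH /= /andP[nis us]].
  by rewrite big_nil mul1r; congr t; apply/row_matrixP => j; rewrite rowK.
pose M := \matrix_j (if j \in s then c j *: row j A else row j A).
rewrite big_cons -mulrA -IH // -/M.
have -> : M = setrow i (row i A) M.
  by apply/row_matrixP => j; rewrite !rowK; case: eqP => // ->; rewrite (negPf nis).
rewrite -multilinear_setrowZ //; congr t; apply/row_matrixP => j.
by rewrite !rowK inE; case: eqP => // ->.
Qed.

Definition basis_rows (I : 'I_k -> 'I_n.+1) : 'M[R]_(k, n.+1) :=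
  \matrix_j delta_mx 0 (I j).

(** Rows are expanded in the standard basis one at a time; the induction is on the list of rows that
    may fail to be basis vectors. The parameter space [X] is the space of base points for polynomial
    dependence, and [bool] for comparing two tensors. *)
Lemma multilinear_ind (X : Type) (C : set (X -> R)) (t : X -> 'M[R]_(k, n.+1) -> R) :
  C (fun=> 0) ->
  (forall c f g, C f -> C g -> C (fun x => c * f x + g x)) ->
  (forall x, multilinear (t x)) ->
  (forall I, C (t ^~ (basis_rows I))) -> forall A, C (t ^~ A).
Proof.
move=> C0 CD ht CI A.
suff H (s : seq 'I_k) : forall A, (forall j, j \notin s -> exists i, row j A = delta_mx 0 i) -> C (t ^~ A).
  by apply: (H (enum 'I_k) A) => j; rewrite mem_enum.
elim: s => [{}A hA|i s IH {}A hA].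
  have [I hI] := @choice _ _ _ (fun j => hA j isT).
  by rewrite [A](_ : _ = basis_rows I) //; apply/row_matrixP => j; rewrite rowK.
rewrite (_ : t ^~ A = fun x => \sum_l A i l * t x (setrow i (delta_mx 0 l) A)); last first.
  apply/funext => x; rewrite -{1}[A](setrow_id i) [X in setrow i X](row_sum_delta (row i A)).
  by rewrite multilinear_setrow_sum //; apply: eq_bigr => l _; rewrite mxE.
have {}IH l : C (t ^~ (setrow i (delta_mx 0 l) A)).
  apply: IH => j js; have [->|ji] := eqVneq j i; first by exists l; rewrite row_setrow.
  by have [|m hm] := hA j; [rewrite inE negb_or ji|exists m; rewrite rowK (negPf ji)].
elim: (index_enum _) => [|l ls IHl].
  by rewrite (_ : (fun=> _) = fun=> 0) //; apply/funext => x; rewrite big_nil.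
rewrite (_ : (fun=> _) = fun x => A i l * t x (setrow i (delta_mx 0 l) A) +
   \sum_(l <- ls) A i l * t x (setrow i (delta_mx 0 l) A)); first exact: CD.
by apply/funext => x; rewrite big_cons.
Qed.

Lemma multilinear_ext t t' : multilinear t -> multilinear t' ->
  (forall I, t (basis_rows I) = t' (basis_rows I)) -> t =1 t'.
Proof.
move=> h h' e A.
(* A function on [bool] is a pair of values, and pairs with equal entries are closed under linear
   combinations. *)
apply: (@multilinear_ind bool [set f | f true = f false] (fun b => if b then t else t')) => //=.
- by move=> c f g -> ->.
- by case.
Qed.

Lemma multilinear_mulmx t (M : 'M[R]_n.+1) :
  multilinear t -> multilinear (fun A => t (A *m M)).
Proof.
move=> h A B C i0 b c e eB eC.
apply: (h _ _ _ i0); first by rewrite !row_mul e mulmxDl !scalemxAl.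
  by rewrite !row'Esub -!mul_rowsub_mx -!row'Esub eB.
by rewrite !row'Esub -!mul_rowsub_mx -!row'Esub eC.
Qed.

Lemma alternating_mulmx t (M : 'M[R]_n.+1) :
  alternating_tensor t -> alternating_tensor (fun A => t (A *m M)).
Proof.
case=> h h'; split=> [|A i1 i2 ne e]; first exact: multilinear_mulmx.
by apply: (h' _ i1 i2) => //; rewrite !row_mul e.
Qed.

Lemma alternating_comb t t' (b c : R) :
  alternating_tensor t -> alternating_tensor t' ->
  alternating_tensor (fun A => b * t A + c * t' A).
Proof.
move=> [h1 h2] [h1' h2']; split=> [A B C i0 x y e eB eC|A i1 i2 ne e].
  by rewrite (h1 _ _ _ _ _ _ e) // (h1' _ _ _ _ _ _ e) //; ring.
by rewrite (h2 _ _ _ ne e) (h2' _ _ _ ne e) !mulr0 addr0.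
Qed.

Lemma basis_rows_diag I (d : 'rV[R]_n.+1) :
  basis_rows I *m diag_mx d = \matrix_j (d 0 (I j) *: row j (basis_rows I)).
Proof.
apply/matrixP => j l; rewrite mul_mx_diag !mxE eqxx /=.
by case: eqP => [->|]; rewrite ?mulr1 ?mul1r ?mulr0 ?mul0r.
Qed.

End Multilinear.

(** Turns the vector inserted by an interior product into a replaced row, so that multilinearity in
    one slot applies to it. *)
Lemma col_mx_setrow (R : realType) (n k : nat) (w : 'rV[R]_n.+1) (v : 'M[R]_(k, n.+1)) :
  (col_mx w v : 'M[R]_(k.+1, n.+1)) = setrow ord0 w (col_mx 0 v : 'M[R]_(1 + k, n.+1)).
Proof.
apply/matrixP => j l; rewrite !mxE; case: (@split_ordP 1 k j) => a ->.
  by rewrite ord1.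
by rewrite [in RHS]/row mxE -[RHS]/(col_mx 0 v (rshift 1 a) l) col_mxEd.
Qed.

(** * Polynomial functions: zeros and parity *)

Section PolynomialFunctions.
Variables (R : realType) (n : nat).
Implicit Types (f g : 'rV[R]_n.+1 -> R) (x : 'rV[R]_n.+1) (r : int).
Local Notation term := (R * {ffun 'I_n.+1 -> nat})%type.
Implicit Types s : seq term.

(* A list of terms (coefficient, exponents), evaluated as a polynomial; the
   exponents may be repeated. *)
Definition eval_terms s x : R := \sum_(t <- s) t.1 * \prod_i x 0 i ^+ t.2 i.

Lemma monomial_reflection i x (m : 'I_n.+1 -> nat) :
  \prod_j reflection i x 0 j ^+ m j = (-1) ^+ m i * \prod_j x 0 j ^+ m j.
Proof.
rewrite (bigD1 i) //= [in RHS](bigD1 i) //= mxE eqxx (exprNn (x 0 i)) -mulrA.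
by congr (_ * (_ * _)); apply: eq_bigr => j /negPf ji; rewrite mxE ji.
Qed.

Lemma poly_funP r f : poly_fun r f <->
  exists2 s : seq term, forall t, t \in s -> (\sum_i t.2 i)%N%:Z <= r & f =1 eval_terms s.
Proof.
split=> [[p hp fE]|[s hs fE]].
  exists [seq (mcoeff m p, [ffun i => m i]) | m <- msupp p].
    move=> t /mapP[m mp ->] /=; apply: le_trans (hp _ mp); rewrite mdegE.
    by under eq_bigr do rewrite ffunE.
  move=> x; rewrite fE mevalE /eval_terms [in RHS]big_map; apply: eq_bigr => m _ /=.
  by congr (_ * _); apply: eq_bigr => i _; rewrite ffunE.
exists (\sum_(t <- s) t.1 *: mpolyX R (Multinom [tuple t.2 i | i < n.+1])).
  move=> m /msupp_sum_le /flattenP[ms /mapP[t]]; rewrite mem_filter /= => ts ->.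
  move=> /msuppZ_le; rewrite msuppX inE => /eqP ->.
  rewrite mdegE; apply: le_trans (hs t ts).
  by rewrite le_eqVlt; apply/orP; left; apply/eqP; congr Posz; apply: eq_bigr => i _;
     rewrite multinomE tnth_mktuple.
move=> x; rewrite fE raddf_sum; apply: eq_bigr => t _ /=.
rewrite mevalZ mevalX; congr (_ * _); apply: eq_bigr => i _.
by rewrite multinomE tnth_mktuple.
Qed.

Lemma poly_fun0 r : @poly_fun R n r (fun=> 0).
Proof. by apply/poly_funP; exists [::] => // x; rewrite /eval_terms big_nil. Qed.

Lemma poly_fun_comb r c f g :
  poly_fun r f -> poly_fun r g -> poly_fun r (fun x => c * f x + g x).
Proof.
move=> /poly_funP[s hs fE] /poly_funP[s' hs' gE]; apply/poly_funP.
exists ([seq (c * t.1, t.2) | t <- s] ++ s').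
  move=> t; rewrite mem_cat => /orP[/mapP[t' ts ->]|]; [exact: (hs _ ts)|exact: hs'].
move=> x; rewrite /eval_terms big_cat big_map fE gE mulr_sumr; congr (_ + _).
by apply: eq_bigr => t _; rewrite mulrA.
Qed.

Lemma poly_funZ r c f : poly_fun r f -> poly_fun r (fun x => c * f x).
Proof.
move=> hf; have := poly_fun_comb c hf (poly_fun0 r).
by under [X in poly_fun _ X -> _]eq_fun do rewrite addr0.
Qed.

Lemma poly_fun_sum r (I : Type) (l : seq I) (F : I -> 'rV[R]_n.+1 -> R) :
  (forall i, poly_fun r (F i)) -> poly_fun r (fun x => \sum_(i <- l) F i x).
Proof.
move=> hF; elim: l => [|i l IH].
  by under eq_fun do rewrite big_nil; exact: poly_fun0.
have := poly_fun_comb 1 (hF i) IH.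
by under eq_fun do rewrite mul1r; under [X in _ -> poly_fun _ X]eq_fun do rewrite big_cons.
Qed.

Lemma poly_fun_coordM r i f : poly_fun r f -> poly_fun (r + 1) (fun x => x 0 i * f x).
Proof.
move=> /poly_funP[s hs fE]; apply/poly_funP.
exists [seq (t.1, [ffun j => (t.2 j + (j == i))%N]) | t : term <- s].
  move=> _ /mapP[t ts ->] /=; under eq_bigr do rewrite ffunE.
  rewrite big_split /= [X in (_ + X)%N](bigD1 i) //= eqxx [X in (1 + X)%N]big1; last by move=> j /negPf->.
  by rewrite addn0 PoszD lerD2r; exact: hs.
move=> x; rewrite fE /eval_terms mulr_sumr big_map; apply: eq_bigr => t _ /=.
rewrite mulrCA; congr (_ * _).
under [in RHS]eq_bigr do rewrite ffunE exprD.
rewrite big_split mulrC /=; congr (_ * _).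
by rewrite (bigD1 i) //= eqxx expr1 big1 ?mulr1 // => j /negPf->.
Qed.

(* Restricted to a line, f is a univariate polynomial. *)
Lemma poly_fun_line_eq0 r f x d (h : nat -> R) :
  poly_fun r f -> injective h -> (forall m, f (x + h m *: d) = 0) -> f x = 0.
Proof.
move=> /poly_funP[s _ fE] hi f0.
pose P := \sum_(t <- s) t.1 *: \prod_i ((x 0 i)%:P + d 0 i *: 'X) ^+ t.2 i : {poly R}.
have PE c : P.[c] = f (x + c *: d).
  rewrite fE horner_sum; apply: eq_bigr => t _; rewrite hornerZ horner_prod.
  by congr (_ * _); apply: eq_bigr => i _; rewrite horner_exp !hornerE !mxE mulrC.
have P0 : P = 0.
  apply/eqP; apply: contraT => P0.
  have := @max_poly_roots _ P (map h (iota 0 (size P))) P0.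
  rewrite map_inj_uniq // iota_uniq size_map size_iota ltnn => -> //.
  by apply/allP => _ /mapP[m _ ->]; rewrite rootE PE f0.
by rewrite -[x]addr0 -(scale0r d) -PE P0 horner0.
Qed.

(** Moving from [x] in the direction (1, ..., 1) by more than the sum of the |x_i| reaches the
    positive orthant, so that line contains infinitely many zeros of [f]. *)
Lemma poly_fun_pos_eq0 r f : poly_fun r f ->
  (forall x, (forall i, 0 < x 0 i) -> f x = 0) -> forall x, f x = 0.
Proof.
move=> hf f0 x; pose c := \sum_i `|x 0 i|.
apply: (poly_fun_line_eq0 (d := const_mx 1) (h := fun m => m.+1%:R + c) hf).
  by move=> m m' /addIr /(mulrIn (oner_neq0 _)) [].
move=> m; apply: f0 => i; rewrite !mxE mulr1.
have : `|x 0 i| <= c by rewrite /c (bigD1 i) //= lerDl sumr_ge0.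
have := ler_norm (- x 0 i); rewrite normrN; have := ltr0Sn R m; lra.
Qed.

(* The signs are those of the coefficient b_I of an even form, where N i is the
   number of occurrences of i in I. *)
Lemma poly_fun_parity r f (N : 'I_n.+1 -> nat) :
  poly_fun r f -> (forall i x, f x = (-1) ^+ N i * f (reflection i x)) ->
  exists2 s : seq term, forall t, t \in s -> (\sum_i t.2 i)%N%:Z <= r /\ (forall i, odd (t.2 i) = odd (N i))
    & f =1 eval_terms s.
Proof.
move=> /poly_funP[s0 hs0 fE0] par.
(* The parity condition is imposed one variable at a time. *)
suff [s hs fE] : exists2 s : seq term, forall t, t \in s -> (\sum_i t.2 i)%N%:Z <= r /\
    (forall i, i \in enum 'I_n.+1 -> odd (t.2 i) = odd (N i)) & f =1 eval_terms s.
  by exists s => // t /hs[? H]; split=> // i; apply: H; rewrite mem_enum.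
elim: (enum _) => [|i l [s hs fE]].
  by exists s0 => // t /hs0 h; split.
exists [seq t : term <- s | odd (t.2 i) == odd (N i)].
  move=> t; rewrite mem_filter => /andP[/eqP e /hs[h h']]; split=> // j.
  by rewrite inE => /orP[/eqP->|/h'].
move=> x; rewrite /eval_terms big_filter big_mkcond /=.
(* In the mean of [f] and its signed reflection, terms of the wrong parity in x_i cancel and the
   others are unchanged. *)
have -> : f x = 2^-1 * (f x + (-1) ^+ N i * f (reflection i x)) by rewrite -par; field.
rewrite !fE mulr_sumr -big_split mulr_sumr; apply: eq_bigr => t _ /=.
rewrite monomial_reflection.
rewrite -(signr_odd _ (N i)) -(signr_odd _ (t.2 i)).
by case: (odd (N i)) (odd (t.2 i)) => [] [] /=; rewrite ?expr0 ?expr1; field.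
Qed.

End PolynomialFunctions.

(** * Substituting squares, and dividing out the odd variables *)

Section SquareSubstitution.
Variables (R : realType) (n : nat).
Local Notation term := (R * {ffun 'I_n.+1 -> nat})%type.

Lemma poly_fun_reflection r (f : 'rV[R]_n.+1 -> R) i :
  poly_fun r f -> poly_fun r (f \o @reflection R n i).
Proof.
move=> /poly_funP[s hs fE]; apply/poly_funP.
exists [seq (t.1 * (-1) ^+ t.2 i, t.2) | t : term <- s].
  by move=> _ /mapP[t ts ->]; exact: hs ts.
move=> x /=; rewrite fE /eval_terms big_map; apply: eq_bigr => t _ /=.
by rewrite monomial_reflection mulrA.
Qed.

Lemma poly_fun_Phi r (f : 'rV[R]_n.+1 -> R) :
  poly_fun r f -> poly_fun (2 * r) (f \o @Phi R n).
Proof.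
move=> /poly_funP[s hs fE]; apply/poly_funP.
exists [seq (t.1, [ffun i => (2 * t.2 i)%N]) | t : term <- s].
  move=> _ /mapP[t ts ->] /=; under eq_bigr do rewrite ffunE.
  by rewrite -big_distrr /= PoszM ler_pM2l //; exact: hs ts.
move=> x /=; rewrite fE /eval_terms big_map; apply: eq_bigr => t _ /=.
by congr (_ * _); apply: eq_bigr => i _; rewrite ffunE mxE exprM.
Qed.

Lemma poly_fun_coords r k (I : 'I_k -> 'I_n.+1) (c : R) f :
  poly_fun r f -> poly_fun (r + k%:Z) (fun x => (\prod_j (c * x 0 (I j))) * f x).
Proof.
move=> hf; rewrite -[k in k%:Z]card_ord cardE.
under eq_fun do rewrite -big_enum /=.
elim: (enum _) => [|j l IH] /=.
  by under eq_fun do rewrite big_nil mul1r; rewrite addr0.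
under eq_fun do rewrite big_cons -!mulrA.
by rewrite -addn1 PoszD addrA; apply: poly_funZ; exact: poly_fun_coordM.
Qed.

(** Each variable occurs at most once among the [I j], so parity forces every monomial of [f] to be
    the product of the u_(I j) times a monomial in the squares. Removing these k factors and halving
    the exponents turns degree 2r + k into r. *)
Lemma poly_fun_Phi_factor r k (I : 'I_k -> 'I_n.+1) (f : 'rV[R]_n.+1 -> R) :
  injective I -> poly_fun (2 * r + k%:Z) f ->
  (forall i x, f x = (\prod_j (if I j == i then -1 else 1)) * f (reflection i x)) ->
  exists2 q, poly_fun r q & forall u, f u = (\prod_j (2 * u 0 (I j))) * q (Phi u).
Proof.
move=> Iinj hf fpar; pose N i := #|[pred j | I j == i]|.
have N_odd i : N i = odd (N i) :> nat.
  have : (N i <= 1)%N.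
    by apply/card_le1_eqP => j j' /eqP e /eqP e'; apply: Iinj; rewrite e e'.
  by case: (N i) => [|[]].
have N_sum : (\sum_i N i = k)%N.
  transitivity (\sum_(j < k) 1)%N; last by rewrite sum1_card card_ord.
  rewrite [RHS](partition_big I predT) //=.
  by apply: eq_bigr => i _; rewrite /N -sum1_card.
have N_prod (u : 'rV[R]_n.+1) : \prod_i u 0 i ^+ N i = \prod_j u 0 (I j).
  rewrite [RHS](partition_big I predT) //=; apply: eq_bigr => i _.
  by rewrite /N -prodr_const; apply: eq_bigr => j /eqP->.
have [|s hs fE] := poly_fun_parity (N := N) hf.
  by move=> i x; rewrite {1}(fpar i) -big_mkcond /N -prodr_const.
have N_half t i : t \in s -> t.2 i = (N i + 2 * (t.2 i)./2)%N.
  move=> /hs[_ h]; rewrite N_odd -h mul2n.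
  by rewrite odd_double_half.
(* The constant 2^-k cancels the factors 2 in the product of the 2 u_(I j). *)
exists (eval_terms [seq ((2 ^+ k)^-1 * t.1, [ffun i => (t.2 i)./2]) | t : term <- s]).
  apply/poly_funP; eexists; last by move=> x; reflexivity.
  move=> _ /mapP[t ts ->] /=; under eq_bigr do rewrite ffunE.
  have [+ _] := hs t ts; under eq_bigr do rewrite N_half //.
  by rewrite big_split /= N_sum -big_distrr /= PoszD PoszM addrC lerD2r ler_pM2l.
move=> u; rewrite big_split /= prodr_const card_ord fE /eval_terms big_map mulr_sumr.
rewrite big_seq [RHS]big_seq; apply: eq_bigr => t ts /=.
under eq_bigr do rewrite N_half // exprD exprM.
rewrite big_split /= N_prod.
under [X in _ = _ * (_ * X)]eq_bigr do rewrite ffunE mxE.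
by field; rewrite expf_neq0 // pnatr_eq0.
Qed.

End SquareSubstitution.

(** * Pullback of ambient forms with diagonal differential *)

Section DiagonalPullback.
Variables (R : realType) (n : nat).

Lemma frame_eq (M : region R n) k (p q : frame M k) :
  base p = base q -> vecs p = vecs q -> p = q.
Proof.
case: p q => x v hx hv [y w hy hw] /= e e'; subst.
by rewrite (Prop_irrelevance hx hy) (Prop_irrelevance hv hw).
Qed.

Lemma eframe_eta k (p : frame (euclid R n) k) : eframe (base p) (vecs p) = p.
Proof. exact: frame_eq. Qed.

(* Pullback under a map phi whose differential at x is diagonal with entries d x. *)
Definition diag_pullback (phi d : 'rV[R]_n.+1 -> 'rV[R]_n.+1) k
    (a : tfield (euclid R n) k) : tfield (euclid R n) k :=
  fun p => a (eframe (phi (base p)) (vecs p *m diag_mx (d (base p)))).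

Definition multilinear_field k (a : tfield (euclid R n) k) :=
  forall x, multilinear (fun v => a (eframe x v)).

Lemma diag_pullback_multilinear phi d k (a : tfield (euclid R n) k) :
  multilinear_field a -> multilinear_field (diag_pullback phi d a).
Proof. by move=> h x; exact: (multilinear_mulmx (diag_mx (d x)) (h (phi x))). Qed.

Lemma coefficient_diag_pullback phi d k (a : tfield (euclid R n) k) I x :
  multilinear_field a ->
  coefficient (diag_pullback phi d a) I x =
    (\prod_j d x 0 (I j)) * coefficient a I (phi x).
Proof.
move=> h; rewrite /coefficient /diag_pullback /= basis_rows_diag.
by rewrite (multilinear_scale _ _ (h (phi x))).
Qed.

(** The condition on [d] says that the radial vector at x is sent to c times the radial vector at
    [phi x]; c is 1 for reflections and 2 for [Phi]. *)
Lemma iX_diag_pullback phi d c k (a : tfield (euclid R n) k.+1) :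
  multilinear_field a -> (forall x, x *m diag_mx (d x) = c *: phi x) ->
  iX (diag_pullback phi d a) = fun p => c * diag_pullback phi d (iX a) p.
Proof.
move=> h e; apply/funext => p; rewrite /iX /diag_pullback /=.
rewrite (@mul_col_mx R 1 k n.+1 n.+1) e.
have := multilinear_setrowZ ord0 c (phi (base p))
  (col_mx 0 (vecs p *m diag_mx (d (base p))) : 'M[R]_(1 + k, n.+1)) (h (phi (base p))).
by rewrite -!col_mx_setrow.
Qed.

(** Polynomiality is assumed for the coefficients only; expansion in basis vectors extends it to any
    constant vectors. *)
Lemma poly_form_eval r k (a : tfield (euclid R n) k) v :
  forms_with (@poly_fun R n r) a -> poly_fun r (fun x => a (eframe x v)).
Proof.
case=> alt co.
apply: (@multilinear_ind R n k 'rV[R]_n.+1 (@poly_fun R n r)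
         (fun x v => a (eframe x v))) => //.
- exact: poly_fun0.
- by move=> c f g; exact: poly_fun_comb.
- by move=> x; case: (alt x).
Qed.

(** Expanding the radial vector as the sum of the x_l e_l multiplies values of [a] by one
    coordinate, hence one more degree. *)
Lemma poly_form_iX_eval r k (a : tfield (euclid R n) k.+1) v :
  forms_with (@poly_fun R n r) a -> poly_fun (r + 1) (fun x => iX a (eframe x v)).
Proof.
move=> ha.
have -> : (fun x => iX a (eframe x v)) = fun x => \sum_l x 0 l *
    a (eframe x (setrow ord0 (delta_mx 0 l) (col_mx 0 v : 'M[R]_(1 + k, n.+1)))).
  apply/funext => x; rewrite /iX /= col_mx_setrow {2}[x]row_sum_delta.
  by rewrite (multilinear_setrow_sum _ _ _ _ (ha.1 x).1).
by apply: poly_fun_sum => l; apply: poly_fun_coordM; exact: poly_form_eval.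
Qed.

End DiagonalPullback.

(** * Averaging over the coordinate reflections *)

Section Symmetrization.
Variables (R : realType) (n : nat).

Lemma forms_multilinear k (C : set ('rV[R]_n.+1 -> R)) (a : tfield (euclid R n) k) :
  forms_with C a -> multilinear_field a.
Proof. by case=> h _ x; case: (h x). Qed.

Lemma forms_comb r k b c (a a' : tfield (euclid R n) k) :
  forms_with (@poly_fun R n r) a -> forms_with (@poly_fun R n r) a' ->
  forms_with (@poly_fun R n r) (fun p => b * a p + c * a' p).
Proof.
move=> [h co] [h' co']; split=> [x|I]; first exact: alternating_comb.
exact: (poly_fun_comb b (co I) (poly_funZ c (co' I))).
Qed.

Definition refl (i : 'I_n.+1) k (a : tfield (euclid R n) k) :=
  diag_pullback (reflection i) (fun=> \row_j (if j == i then -1 else 1)) a.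

Lemma reflection_diag i (u : 'rV[R]_n.+1) :
  u *m diag_mx (\row_j (if j == i then -1 else 1)) = reflection i u.
Proof.
by apply/rowP => j; rewrite mul_mx_diag !mxE; case: eqP; rewrite ?mulrN mulr1.
Qed.

Lemma reflK i k : involutive (@refl i k).
Proof.
move=> a; apply/funext => p; congr a; apply: frame_eq => /=.
  by apply/rowP => j; rewrite !mxE; case: eqP; rewrite ?opprK.
apply/matrixP => j l; rewrite !mul_mx_diag !mxE.
by case: eqP; rewrite ?mulrN !mulr1 ?opprK.
Qed.

Lemma reflC i j k (a : tfield (euclid R n) k) : refl i (refl j a) = refl j (refl i a).
Proof.
apply/funext => p; congr a; apply: frame_eq => /=.
  by apply/rowP => l; rewrite !mxE; case: eqP => //; case: eqP.
by rewrite -!mulmxA diag_mxC.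
Qed.

Lemma forms_refl i r k (a : tfield (euclid R n) k) :
  forms_with (@poly_fun R n r) a -> forms_with (@poly_fun R n r) (refl i a).
Proof.
move=> [h co]; split=> [x|I]; first exact: (alternating_mulmx _ (h (reflection i x))).
rewrite [coefficient _ _](_ : _ = fun x =>
    (\prod_j (\row_l (if l == i then -1 else 1) : 'rV[R]_n.+1) 0 (I j)) *
    coefficient a I (reflection i x)).
  exact: (poly_funZ _ (poly_fun_reflection i (co I))).
apply/funext => x; rewrite coefficient_diag_pullback //.
exact: (forms_multilinear (C := @poly_fun R n r)).
Qed.

Definition average (i : 'I_n.+1) k (a : tfield (euclid R n) k) : tfield (euclid R n) k :=
  fun p => 2^-1 * a p + 2^-1 * refl i a p.

Lemma refl_average i k (a : tfield (euclid R n) k) : refl i (average i a) = average i a.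
Proof.
apply/funext => p; rewrite /average [RHS]addrC.
by rewrite -[X in _ = _ + _ * X](congr1 (fun f => f p) (reflK i a)).
Qed.

Lemma refl_averageC i j k (a : tfield (euclid R n) k) :
  refl i (average j a) = average j (refl i a).
Proof. by rewrite {2}/average reflC. Qed.

Lemma iX_average i r k (a : tfield (euclid R n) k.+1) :
  forms_with (@poly_fun R n r) a -> iX (average i a) = average i (iX a).
Proof.
move=> /forms_multilinear h.
have e : iX (refl i a) = refl i (iX a).
  rewrite /refl (iX_diag_pullback (c := 1)) //; last first.
    by move=> x; rewrite scale1r reflection_diag.
  by apply/funext => p; rewrite mul1r.
by apply/funext => p; rewrite [RHS]/average -e.
Qed.

Lemma restrict_refl i k (a : tfield (euclid R n) k) :
  restrict (@sub_euclid R n (sphere R n)) (refl i a) =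
  pullback (@reflection_map R n i) (restrict (@sub_euclid R n (sphere R n)) a).
Proof.
apply/funext => p; congr a; apply: frame_eq => //=.
apply/row_matrixP => j; rewrite rowK row_mul diff_reflection.
exact: reflection_diag.
Qed.

Lemma restrict_average i k (a : tfield (euclid R n) k) :
  let res := restrict (@sub_euclid R n (sphere R n)) (k := k) in
  even_forms R n k (res a) -> res (average i a) = res a.
Proof.
move=> res ev; apply/funext => p.
rewrite -[LHS]/(2^-1 * res a p + 2^-1 * res (refl i a) p) /res restrict_refl ev.
by rewrite ![2^-1 * _]mulrC -splitr.
Qed.

(** The reflections commute, so this composite of averages is the mean over the whole group that
    they generate. *)
Definition symmetrize k (a : tfield (euclid R n) k) : tfield (euclid R n) k :=
  foldr (fun i => @average i k) a (enum 'I_n.+1).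

Lemma forms_symmetrize r k (a : tfield (euclid R n) k) :
  forms_with (@poly_fun R n r) a -> forms_with (@poly_fun R n r) (symmetrize a).
Proof.
by move=> h; rewrite /symmetrize; elim: (enum _) => //= i s IH; apply: forms_comb => //;
  exact: forms_refl.
Qed.

(** [refl i] commutes past the averages in the other directions and is absorbed by the one in
    direction i. *)
Lemma refl_symmetrize i k (a : tfield (euclid R n) k) : refl i (symmetrize a) = symmetrize a.
Proof.
have : i \in enum 'I_n.+1 by rewrite mem_enum.
rewrite /symmetrize; elim: (enum _) => //= j s IH; rewrite inE.
by have [<- _|_ /= /IH e] := eqVneq i j; rewrite ?refl_average // refl_averageC e.
Qed.

Lemma iX_symmetrize r k (a : tfield (euclid R n) k.+1) :
  forms_with (@poly_fun R n r) a -> iX (symmetrize a) = symmetrize (iX a).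
Proof.
move=> h; rewrite /symmetrize.
(* Polynomiality is carried along because [iX_average] assumes it at each stage. *)
suff [_ ->] : forms_with (@poly_fun R n r) (foldr (fun i => @average i _) a (enum 'I_n.+1)) /\
  iX (foldr (fun i => @average i _) a (enum 'I_n.+1)) =
  foldr (fun i => @average i _) (iX a) (enum 'I_n.+1) by [].
elim: (enum _) => //= i s [h' e]; split; last by rewrite (iX_average i h') e.
by apply: forms_comb => //; exact: forms_refl.
Qed.

Lemma restrict_symmetrize k (a : tfield (euclid R n) k) :
  let res := restrict (@sub_euclid R n (sphere R n)) (k := k) in
  even_forms R n k (res a) -> res (symmetrize a) = res a.
Proof.
move=> res ev; rewrite /symmetrize; elim: (enum _) => //= i s IH.
(* The partial average has the same restriction, which is thus still even, so the next average
   preserves it. *)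
by rewrite /res restrict_average -/res IH.
Qed.

End Symmetrization.

(** * Pullback under [Phi] on the ambient space, and its surjectivity *)

Section PhiPullback.
Variables (R : realType) (n : nat).

Definition sqrt_row (x : 'rV[R]_n.+1) : 'rV[R]_n.+1 := \row_i Num.sqrt (x 0 i).

Lemma Phi_sqrt_row (x : 'rV[R]_n.+1) : (forall i, 0 <= x 0 i) -> Phi (sqrt_row x) = x.
Proof. by move=> x0; apply/rowP => i; rewrite !mxE sqr_sqrtr. Qed.

(* Since 0^-1 = 0, this is the inverse of [*m diag_mx (2 *: u)] also when some
   u_i = 0, provided the corresponding columns of v vanish. *)
Definition unscale k (u : 'rV[R]_n.+1) (v : 'M[R]_(k, n.+1)) :=
  v *m diag_mx (\row_i (2 * u 0 i)^-1).

Lemma unscaleK k (u : 'rV[R]_n.+1) (v : 'M[R]_(k, n.+1)) :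
  (forall i, u 0 i = 0 -> forall j, v j i = 0) ->
  unscale u v *m diag_mx (2 *: u) = v.
Proof.
move=> uv; apply/matrixP => j i; rewrite /unscale !mul_mx_diag !mxE.
have [ui0|ui0] := eqVneq (u 0 i) 0; last by field.
by rewrite (uv i ui0 j) !mul0r.
Qed.

Definition Phi_lift k (a : tfield (euclid R n) k) :=
  diag_pullback (@Phi R n) (fun u => 2 *: u) a.

Lemma restrict_Phi k (a : tfield (euclid R n) k) :
  Phi_pullback R n k (restrict (@sub_euclid R n (simplex R n)) a) =
  restrict (@sub_euclid R n (sphere R n)) (Phi_lift a).
Proof.
apply/funext => p; congr a; apply: frame_eq => //=.
apply/row_matrixP => j; rewrite rowK diff_Phi row_mul.
by apply/rowP => i; rewrite mul_mx_diag !mxE mulrC.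
Qed.

Lemma coefficient_Phi_lift k (a : tfield (euclid R n) k) I : multilinear_field a ->
  coefficient (Phi_lift a) I = fun x => (\prod_j (2 * x 0 (I j))) * coefficient a I (Phi x).
Proof.
move=> h; apply/funext => x; rewrite coefficient_diag_pullback //.
by congr (_ * _); apply: eq_bigr => j _; rewrite mxE.
Qed.

(** Composition with [Phi] doubles the degree, and each of the k differentials d(u_i^2) = 2 u_i du_i
    contributes one more. *)
Lemma forms_Phi_lift r k (a : tfield (euclid R n) k) :
  forms_with (@poly_fun R n r) a ->
  forms_with (@poly_fun R n (2 * r + k%:Z)) (Phi_lift a).
Proof.
move=> ha; split=> [x|I]; first exact: (alternating_mulmx (diag_mx (2 *: x)) (ha.1 (Phi x))).
rewrite coefficient_Phi_lift; last exact: forms_multilinear ha.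
by apply: (poly_fun_coords I 2); exact: poly_fun_Phi (ha.2 I).
Qed.

Lemma iX_Phi_lift k (a : tfield (euclid R n) k.+1) : multilinear_field a ->
  iX (Phi_lift a) = fun p => 2 * Phi_lift (iX a) p.
Proof.
move=> h; apply: iX_diag_pullback => // x.
by apply/rowP => i; rewrite mul_mx_diag !mxE; ring.
Qed.

(** The sum of the tensors q_I dx_(I 1) ⊗ ... ⊗ dx_(I k) over all multi-indices: multilinear for
    every [q], but alternating only for suitable ones. *)
Definition form_of_coefficients k (q : {ffun 'I_k -> 'I_n.+1} -> 'rV[R]_n.+1 -> R) :
    tfield (euclid R n) k :=
  fun p => \sum_(I : {ffun 'I_k -> 'I_n.+1}) (\prod_j vecs p j (I j)) * q I (base p).

Lemma form_of_coefficients_multilinear k q : multilinear_field (@form_of_coefficients k q).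
Proof.
move=> x A B C i0 b c e eB eC; rewrite /form_of_coefficients /= !mulr_sumr -big_split /=.
apply: eq_bigr => I _.
have P (M : 'M[R]_(k, n.+1)) :
    \prod_j M j (I j) = M i0 (I i0) * \prod_(j | j != i0) M j (I j).
  by rewrite (bigD1 i0).
rewrite !P.
have -> : A i0 (I i0) = b * B i0 (I i0) + c * C i0 (I i0).
  by have /rowP/(_ (I i0)) := e; rewrite !mxE.
have -> : \prod_(j | j != i0) B j (I j) = \prod_(j | j != i0) A j (I j).
  by apply: eq_bigr => j; exact: row'_entry.
have -> : \prod_(j | j != i0) C j (I j) = \prod_(j | j != i0) A j (I j).
  by apply: eq_bigr => j; exact: row'_entry.
ring.
Qed.

Lemma coefficient_form_of_coefficients k q I :
  coefficient (@form_of_coefficients k q) I = q (finfun I).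
Proof.
apply/funext => x; rewrite /coefficient /form_of_coefficients /=.
rewrite (bigD1 (finfun I)) //= [X in _ + X]big1 => [|J JI].
  by rewrite addr0 big1 ?mul1r // => j _; rewrite !mxE ffunE !eqxx.
have /existsP[j jI] : [exists j, J j != I j].
  apply: contraT; rewrite negb_exists => /forallP e; case/eqP: JI.
  by apply/ffunP => j; rewrite ffunE; apply/eqP; have := e j; rewrite negbK.
by rewrite (bigD1 j) //= !mxE (negPf jI) andbF !mul0r.
Qed.

Lemma Phi_lift_surj r k (a : tfield (euclid R n) k) :
  forms_with (@poly_fun R n (2 * r + k%:Z)) a -> (forall i, refl i a = a) ->
  exists2 b, forms_with (@poly_fun R n r) b & Phi_lift b = a.
Proof.
move=> ha inv; have mla := forms_multilinear ha.
have [q hq] : exists q, forall I : {ffun 'I_k -> 'I_n.+1}, poly_fun r (q I) /\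
    forall u, coefficient a I u = (\prod_j (2 * u 0 (I j))) * q I (Phi u).
  suff H (I : {ffun 'I_k -> 'I_n.+1}) : exists q : 'rV[R]_n.+1 -> R, poly_fun r q /\
      forall u, coefficient a I u = (\prod_j (2 * u 0 (I j))) * q (Phi u).
    by have [q hq] := choice H; exists q.
  have [/injectiveP Iinj|/injectivePn[j1 [j2 j12 Ij]]] := boolP (injectiveb I).
    have [|q hq e] := poly_fun_Phi_factor Iinj (ha.2 I); last by exists q.
    move=> i x; rewrite -{1}(inv i) coefficient_diag_pullback //; congr (_ * _).
    by apply: eq_bigr => j _; rewrite mxE.
  (* For a repeated index the coefficient vanishes by alternation. *)
  exists (fun=> 0); split=> [|u]; first exact: poly_fun0.
  rewrite mulr0; apply: ((ha.1 u).2 _ j1 j2) => //.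
  by rewrite !rowK Ij.
pose b := form_of_coefficients q.
have mlb : multilinear_field b by exact: form_of_coefficients_multilinear.
have ba : Phi_lift b = a.
  apply/funext => p; rewrite -(eframe_eta p).
  apply: (@multilinear_ext R n k (fun v => Phi_lift b (eframe (base p) v))
            (fun v => a (eframe (base p) v))) => // [|I].
    exact: (diag_pullback_multilinear _ _ mlb).
  rewrite -[LHS]/(coefficient (Phi_lift b) I (base p)) coefficient_Phi_lift //.
  rewrite coefficient_form_of_coefficients.
  have := (hq (finfun I)).2 (base p).
  have -> : coefficient a (finfun I) = coefficient a I.
    by congr coefficient; apply/funext => j; rewrite ffunE.
  by rewrite /coefficient => ->; congr (_ * _); apply: eq_bigr => j _; rewrite ffunE.
exists b => //; split=> [x|I]; last first.
  by rewrite coefficient_form_of_coefficients; exact: (hq _).1.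
split=> [|A i1 i2 i12 e]; first exact: mlb.
(* For fixed vectors the value is polynomial in the base point, so positive points suffice. There
   [Phi] has a square-root preimage with invertible differential, and alternation is inherited from
   [a]. *)
have hb : poly_fun r (fun x => b (eframe x A)).
  by apply: poly_fun_sum => I; exact: (poly_funZ (\prod_j A j (I j)) (hq I).1).
apply: (poly_fun_pos_eq0 hb) => {}x x0.
have u0 i : sqrt_row x 0 i = 0 -> forall j, A j i = 0.
  by move/eqP; rewrite mxE sqrtr_eq0 leNgt x0.
have -> : b (eframe x A) = Phi_lift b (eframe (sqrt_row x) (unscale (sqrt_row x) A)).
  rewrite /Phi_lift /diag_pullback /= unscaleK // Phi_sqrt_row // => i.
  exact: ltW.
rewrite ba; apply: ((ha.1 _).2 _ i1 i2 i12).
by rewrite !row_mul e.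
Qed.

End PhiPullback.

(** * Smoothness of pullbacks under [Phi] *)

Section SmoothPullback.
Variables (R : realType) (n : nat).
Local Notation E := 'rV[R]_n.+1.

(* A class of functions that contains the coefficients of pullbacks under Phi
   and is stable under directional derivatives. *)
Inductive Phi_smooth : (E -> R) -> Prop :=
| Phi_smooth_cst c : Phi_smooth (cst c)
| Phi_smooth_coord i : Phi_smooth (fun u => u 0 i)
| Phi_smooth_comp g : smooth_fun g -> Phi_smooth (g \o @Phi R n)
| Phi_smoothD f g : Phi_smooth f -> Phi_smooth g -> Phi_smooth (f + g)
| Phi_smoothM f g : Phi_smooth f -> Phi_smooth g -> Phi_smooth (f * g).

Lemma Phi_smooth_sum (I : Type) (l : seq I) (F : I -> E -> R) :
  (forall i, Phi_smooth (F i)) -> Phi_smooth (fun x => \sum_(i <- l) F i x).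
Proof.
move=> hF; elim: l => [|i l IH].
  by under eq_fun do rewrite big_nil; exact: Phi_smooth_cst.
by under eq_fun do rewrite big_cons; exact: Phi_smoothD.
Qed.

Lemma Phi_smooth_prod (I : Type) (l : seq I) (F : I -> E -> R) :
  (forall i, Phi_smooth (F i)) -> Phi_smooth (fun x => \prod_(i <- l) F i x).
Proof.
move=> hF; elim: l => [|i l IH].
  by under eq_fun do rewrite big_nil; exact: Phi_smooth_cst.
by under eq_fun do rewrite big_cons; exact: Phi_smoothM.
Qed.

(** The fold in [smooth_fun] differentiates along the last direction of the list first, hence the
    appended [v]. *)
Lemma smooth_derive (f : E -> R) v : smooth_fun f -> smooth_fun ('D_v f).
Proof. by move=> sf s x; have := sf (rcons s v) x; rewrite foldr_rcons. Qed.

Lemma Phi_smooth_differentiable f u : Phi_smooth f -> differentiable f u.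
Proof.
elim=> {f} [c|i|g sg|f g _ df _ dg|f g _ df _ dg].
- exact: differentiable_cst.
- exact: differentiable_coord.
- apply: differentiable_comp; first exact: differentiable_Phi.
  exact: (sg [::]).
- exact: differentiableD.
- exact: differentiableM.
Qed.

(** The chain rule, arranged so that each summand is a constant times a coordinate times a function
    of [Phi u]. *)
Lemma derive_Phi_comp (g : E -> R) u v : differentiable g (Phi u) ->
  'D_v (g \o @Phi R n) u =
    \sum_i (2 * v 0 i) * u 0 i * 'D_(delta_mx 0 i) g (Phi u).
Proof.
move=> dg; have dP := differentiable_Phi u.
rewrite deriveE; last exact: differentiable_comp.
rewrite diff_comp //= diff_Phi [X in 'd g _ X]row_sum_delta linear_sum.
apply: eq_bigr => i _; rewrite linearZ /= deriveE // mxE -[_ *: _]/(_ * _).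
by rewrite -!mulrA [u 0 i * (v 0 i * _)]mulrCA.
Qed.

Lemma Phi_smooth_derive f v : Phi_smooth f -> Phi_smooth ('D_v f).
Proof.
elim=> {f} [c|i|g sg|f g sf df sg dg|f g sf df sg dg].
- rewrite (_ : 'D_v _ = cst 0); first exact: Phi_smooth_cst.
  by apply/funext => u; rewrite derive_cst.
- rewrite (_ : 'D_v _ = cst (v 0 i)); first exact: Phi_smooth_cst.
  by apply/funext => u; rewrite deriveE ?diff_coord //; exact: differentiable_coord.
- have -> : 'D_v (g \o @Phi R n) = fun u =>
      \sum_i ((cst (2 * v 0 i) : E -> R) * (fun u : E => u 0 i) *
              ('D_(delta_mx 0 i) g \o @Phi R n)) u.
    by apply/funext => u; rewrite derive_Phi_comp //; exact: (sg [::]).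
  apply: Phi_smooth_sum => i; apply: Phi_smoothM; last first.
    by apply: Phi_smooth_comp; exact: smooth_derive.
  by apply: Phi_smoothM; [exact: Phi_smooth_cst|exact: Phi_smooth_coord].
- rewrite (_ : 'D_v _ = 'D_v f + 'D_v g); first exact: Phi_smoothD.
  by apply/funext => u; rewrite deriveD //; apply: diff_derivable;
    exact: Phi_smooth_differentiable.
- rewrite (_ : 'D_v _ = f * 'D_v g + g * 'D_v f).
    by apply: Phi_smoothD; exact: Phi_smoothM.
  by apply/funext => u; rewrite deriveM //; apply: diff_derivable;
    exact: Phi_smooth_differentiable.
Qed.

Lemma Phi_smooth_smooth f : Phi_smooth f -> smooth_fun f.
Proof.
move=> sf s x; apply: Phi_smooth_differentiable.
by elim: s => //= v s; exact: Phi_smooth_derive.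
Qed.

Lemma smooth_forms_Phi_lift k (a : tfield (euclid R n) k) :
  forms_with (@smooth_fun R n) a -> forms_with (@smooth_fun R n) (Phi_lift a).
Proof.
move=> ha; split=> [x|I].
  exact: (alternating_mulmx (diag_mx (2 *: x)) (ha.1 (Phi x))).
rewrite coefficient_Phi_lift; last exact: forms_multilinear ha.
apply: Phi_smooth_smooth.
apply: (@Phi_smoothM (fun x => \prod_j (2 * x 0 (I j)))); last first.
  by apply: Phi_smooth_comp; exact: ha.2.
apply: Phi_smooth_prod => j.
by apply: (@Phi_smoothM (cst 2)); [exact: Phi_smooth_cst|exact: Phi_smooth_coord].
Qed.

End SmoothPullback.

(** * Injectivity and the boundary conditions *)

Section Injectivity.
Variables (R : realType) (n k : nat).
Local Notation T := (simplex R n).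
Local Notation S := (sphere R n).
Local Notation resT := (restrict (@sub_euclid R n T) (k := k)).

(** Take square roots of the coordinates and divide the vectors by 2 u_i. The result is tangent to
    the sphere: the sum of the u_i v_i / (2 u_i) is half the sum of the v_i, since v_i = 0 wherever
    u_i = 0. *)
Lemma Phi_push_surj (p : frame T k) :
  (forall i, base p 0 i = 0 -> forall j, vecs p j i = 0) ->
  exists2 q : frame S k, push_frame (@Phi_map R n) q = p &
    forall i, base p 0 i = 0 -> base q 0 i = 0.
Proof.
move=> pv; have [x0 x1] := base_in p.
pose u := sqrt_row (base p).
have uP : Phi u = base p by exact: Phi_sqrt_row.
have u0 i : u 0 i = 0 -> forall j, vecs p j i = 0.
  by move=> ui; apply: pv; rewrite -uP mxE ui expr0n.
have uS : points S u.
  by rewrite /= -x1; apply: eq_bigr => i _; rewrite mxE sqr_sqrtr.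
have wS j : tangent S u (row j (unscale u (vecs p))).
  have /= := vecs_in p j; rewrite /unscale => v0.
  transitivity (2^-1 * \sum_i row j (vecs p) 0 i); last by rewrite v0 mulr0.
  rewrite mulr_sumr; apply: eq_bigr => i _.
  rewrite mul_mx_diag !mxE; have [ui|ui] := eqVneq (Num.sqrt (base p 0 i)) 0.
    by rewrite (u0 i) ?mxE // mul0r !mulr0.
  by field.
exists (Frame uS wS); last by move=> i pi; rewrite /= mxE pi sqrtr0.
apply: frame_eq => //=; rewrite -[RHS](unscaleK u0); move: (unscale _ _) => w.
apply/row_matrixP => j; rewrite rowK diff_Phi row_mul.
by apply/rowP => i; rewrite mul_mx_diag !mxE mulrC.
Qed.

(** Satisfied by representatives of both polynomial families, which can then be treated together. *)
Definition poly_eval r (a : tfield (euclid R n) k) :=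
  forall v, poly_fun r (fun x => a (eframe x v)).

(* Joining p to y inside the face of y, the value of the form with the vectors
   of p is polynomial along the segment and vanishes on its interior. *)
Lemma vanish_from_face r a (p : frame T k) (y : 'rV[R]_n.+1) :
  poly_eval r a -> points T y ->
  (forall i, y 0 i = 0 -> base p 0 i = 0) ->
  (forall q : frame T k, vecs q = vecs p ->
     (forall i, base q 0 i = 0 <-> y 0 i = 0) -> resT a q = 0) ->
  resT a p = 0.
Proof.
move=> ha [y0 y1] yp hq; have [x0 x1] := base_in p.
(* The numbers 1/(m+2) are infinitely many parameters strictly between 0 and 1. *)
pose h (m : nat) : R := m.+2%:R^-1.
have h01 m : 0 < h m < 1.
  by rewrite invr_gt0 ltr0Sn invf_lt1 ?ltr0Sn // ltr1n.
rewrite -[LHS]/(a (incl_frame _ p)) -(eframe_eta (incl_frame _ p)) /=.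
apply: (poly_fun_line_eq0 (d := y - base p) (h := h) (ha (vecs p))).
  by move=> m m' /invr_inj /(mulrIn (oner_neq0 _)) [].
move=> m; have /andP[t0 t1] := h01 m; set t := h m in t0 t1 *.
set z := base p + t *: (y - base p).
have zE i : z 0 i = (1 - t) * base p 0 i + t * y 0 i by rewrite !mxE; ring.
have zT : points T z.
  split=> [i|]; first by rewrite zE addr_ge0 // mulr_ge0 // ?subr_ge0 ltW.
  under eq_bigr do rewrite zE.
  by rewrite big_split /= -!mulr_sumr x1 y1; ring.
have -> : eframe z (vecs p) =
    incl_frame (@sub_euclid R n T) (@Frame _ _ T k z (vecs p) zT (vecs_in p)).
  exact: frame_eq.
apply: hq => // i /=; rewrite zE; split=> [/eqP|yi]; last first.
  by rewrite yi yp // !mulr0 addr0.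
rewrite paddr_eq0 ?mulr_ge0 // ?subr_ge0 ?ltW // => /andP[_].
by rewrite mulf_eq0 gt_eqF //= => /eqP.
Qed.

Lemma Phi_pullback_inj r (a a' : tfield (euclid R n) k) :
  poly_eval r a -> poly_eval r a' ->
  Phi_pullback R n k (resT a) = Phi_pullback R n k (resT a') -> resT a = resT a'.
Proof.
move=> ha ha' e; apply/funext => p; apply/eqP; rewrite -subr_eq0; apply/eqP.
pose d : tfield (euclid R n) k := fun p => -1 * a' p + a p.
have hd : poly_eval r d by move=> v; exact: poly_fun_comb.
have dE (q : frame T k) : resT d q = resT a q - resT a' q.
  by rewrite -[LHS]/(-1 * resT a' q + resT a q) mulN1r addrC.
(* No coordinate of the barycenter vanishes, so only interior base points remain, and there every
   tangent frame lifts through [Phi]. *)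
rewrite -dE; apply: (vanish_from_face (y := const_mx n.+1%:R^-1) hd).
- split=> [i|]; first by rewrite mxE invr_ge0.
  under eq_bigr do rewrite mxE.
  by rewrite sumr_const card_ord -[LHS]mulr_natl mulfV // pnatr_eq0.
- by move=> i /eqP; rewrite mxE invr_eq0 pnatr_eq0.
move=> q _ q0; have [|q' qE _] := @Phi_push_surj q.
  by move=> i /q0 /eqP; rewrite mxE invr_eq0 pnatr_eq0.
rewrite dE -qE; apply/eqP; rewrite subr_eq0; apply/eqP.
exact: (congr1 (fun f => f q') e).
Qed.

(** Where u_i = 0, the component 2 u_i v_i of the pushed vector vanishes, so the pushed frame is
    tangent to facet i. *)
Lemma vanishing_trace_Phi (b : tfield T k) :
  vanishing_trace R n k b -> vanishing_on_Gamma R n k (Phi_pullback R n k b).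
Proof.
move=> hb p [i ui]; pose q := push_frame (@Phi_map R n) p.
have qF : points (facet R i) (base q).
  by split; [exact: base_in|rewrite mxE ui expr0n].
have vF j : tangent (facet R i) (base q) (row j (vecs q)).
  split; first exact: vecs_in.
  by rewrite rowK diff_Phi mxE ui mulr0 mul0r.
apply: (etrans _ (congr1 (fun f => f (Frame qF vF)) (hb i))).
by congr b; exact: frame_eq.
Qed.

Lemma vanishing_on_Gamma_Phi r (a : tfield (euclid R n) k) : (0 < n)%N ->
  poly_eval r a -> vanishing_on_Gamma R n k (Phi_pullback R n k (resT a)) ->
  vanishing_trace R n k (resT a).
Proof.
move=> n0 ha hG i; apply/funext => p; rewrite -[LHS]/(resT a (incl_frame _ p)).
have [_ pi] := base_in p; have vi j : vecs p j i = 0.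
  by have [_] := vecs_in p j; rewrite mxE.
(* The barycenter of facet i: as [0 < n], the n weights 1/n sum to 1 and only coordinate i
   vanishes. *)
pose y : 'rV[R]_n.+1 := \row_l (if l == i then 0 else n%:R^-1).
have y0 l : y 0 l = 0 -> l = i.
  by rewrite mxE; case: eqP => // _ /eqP; rewrite invr_eq0 pnatr_eq0 -[_ == _]negbK -lt0n n0.
apply: (vanish_from_face (y := y) ha).
- split=> [l|]; first by rewrite mxE; case: eqP; rewrite // invr_ge0.
  rewrite (bigD1 i) //= mxE eqxx add0r.
  under eq_bigr => l /negPf li do rewrite mxE li.
  rewrite sumr_const (cardC1 i) card_ord -[LHS]mulr_natl mulfV //.
  by rewrite pnatr_eq0 -lt0n.
- by move=> l /y0 ->.
move=> q vq q0; have [|q' qE q'0] := @Phi_push_surj q.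
  by move=> l /q0 /y0 -> j; rewrite vq /= vi.
rewrite -qE; apply: hG; exists i; apply: q'0; apply/q0.
by rewrite mxE eqxx.
Qed.

(** [Phi] is invariant under each reflection, so a frame and its reflection have the same image. *)
Lemma Phi_pullback_even (b : tfield T k) : even_forms R n k (Phi_pullback R n k b).
Proof.
move=> i; apply/funext => p; congr b; apply: frame_eq => /=.
  by apply/rowP => j; rewrite !mxE; case: eqP => _; rewrite ?sqrrN.
apply/row_matrixP => j; rewrite [LHS]rowK [RHS]rowK rowK.
apply: etrans (congr1 _ (diff_reflection i (base p) _)) _.
apply: etrans (diff_Phi _ _) (etrans _ (esym (diff_Phi _ _))).
by apply/rowP => l; rewrite !mxE; case: eqP => _; rewrite ?mulrN ?mulNr ?opprK.
Qed.

(** Gives both the unrestricted and the boundary version for one family: any preimage of a form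
    vanishing on Gamma has vanishing trace. *)
Lemma Phi_pullback_bij r (P : set (tfield T k)) (Q : set (tfield S k)) : (0 < n)%N ->
  (forall b, P b -> exists2 a, poly_eval r a & resT a = b) ->
  (forall b, P b -> Q (Phi_pullback R n k b)) ->
  (forall c, Q c -> even_forms R n k c -> exists2 b, P b & Phi_pullback R n k b = c) ->
  set_bij P (Q `&` even_forms R n k) (Phi_pullback R n k) /\
  set_bij (P `&` vanishing_trace R n k)
    (Q `&` vanishing_on_Gamma R n k `&` even_forms R n k) (Phi_pullback R n k).
Proof.
move=> n0 Ppoly PQ QP; split; split.
- by move=> b Pb; split; [exact: PQ|exact: Phi_pullback_even].
- move=> b b'; rewrite !inE => /Ppoly[a ha <-] /Ppoly[a' ha' <-].
  exact: Phi_pullback_inj ha ha'.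
- by move=> c [Qc ec]; have [b Pb bc] := QP c Qc ec; exists b.
- move=> b [Pb b0]; split; last exact: Phi_pullback_even.
  by split; [exact: PQ|exact: vanishing_trace_Phi].
- move=> b b'; rewrite !inE => -[/Ppoly[a ha <-] _] [/Ppoly[a' ha' <-] _].
  exact: Phi_pullback_inj ha ha'.
- move=> c [[Qc c0] ec]; have [b Pb bc] := QP c Qc ec; exists b => //; split=> //.
  have [a ha ab] := Ppoly b Pb; rewrite -ab.
  by apply: (vanishing_on_Gamma_Phi n0 ha); rewrite ab bc.
Qed.

End Injectivity.

Theorem theorem3p1 (R : realType) (n k : nat) (r : int)
    (n_ge1 : (1 <= n)%N) (k_le_n : (k <= n)%N) :
  let T := simplex R n in
  let S := sphere R n in
  let s : int := 2 * r + k%:Z in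
  let e := even_forms R n k in
  let ring0 := vanishing_trace R n k in
  let ring00 := vanishing_on_Gamma R n k in
  let Phistar := Phi_pullback R n k in
  [/\ linear Phistar,
      set_fun (forms T k) (forms S k) Phistar &
  [/\ set_bij (polyforms T r k) (polyforms S s k `&` e) Phistar,
      set_bij (polyforms_minus T r k) (polyforms_minus S s k `&` e) Phistar,
      set_bij (polyforms T r k `&` ring0) (polyforms S s k `&` ring00 `&` e) Phistar &
      set_bij (polyforms_minus T r k `&` ring0) (polyforms_minus S s k `&` ring00 `&` e) Phistar]].
Proof.
move=> T S s e ring0 ring00 Phistar.
(* Pulling back a (k+1)-form of degree r - 1 gives exactly the degree s - 1 allowed under [iX] on
   the sphere. *)
have s1 : s - 1 = 2 * (r - 1) + k.+1%:Z by rewrite /s; lia.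
have [full full0] : set_bij (polyforms T r k) (polyforms S s k `&` e) Phistar /\
    set_bij (polyforms T r k `&` ring0) (polyforms S s k `&` ring00 `&` e) Phistar.
  apply: (@Phi_pullback_bij R n k r) => //.
  - by move=> _ [a ha <-]; exists a => // v; exact: poly_form_eval.
  - move=> _ [a ha <-]; rewrite restrict_Phi; exists (Phi_lift a) => //.
    exact: forms_Phi_lift.
  - move=> _ [a ha <-] ev.
    have [b hb ba] := Phi_lift_surj (forms_symmetrize ha) (fun i => refl_symmetrize i a).
    exists (restrict (@sub_euclid R n T) b); first by exists b.
    by rewrite restrict_Phi ba restrict_symmetrize.
have [minus minus0] : set_bij (polyforms_minus T r k) (polyforms_minus S s k `&` e) Phistar /\
    set_bij (polyforms_minus T r k `&` ring0) (polyforms_minus S s k `&` ring00 `&` e) Phistar.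
  apply: (@Phi_pullback_bij R n k r) => //.
  - move=> _ [_ [a ha <-] <-]; exists (iX a) => // v.
    by have := poly_form_iX_eval v ha; rewrite subrK.
  - move=> _ [_ [a ha <-] <-]; rewrite restrict_Phi; exists (Phi_lift (iX a)) => //.
    (* The factor 1/2 undoes the 2 of [iX_Phi_lift]; the zero term gives the shape of
       [forms_comb]. *)
    exists (fun p => 2^-1 * Phi_lift a p + 0 * Phi_lift a p).
      by rewrite s1; apply: forms_comb; exact: forms_Phi_lift.
    apply/funext => p; rewrite -[LHS]/(2^-1 * iX (Phi_lift a) p + 0 * iX (Phi_lift a) p).
    rewrite mul0r addr0 iX_Phi_lift ?mulKf ?pnatr_eq0 //.
    exact: forms_multilinear ha.
  - move=> _ [_ [a ha <-] <-] ev; rewrite s1 in ha.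
    have [b hb ba] := Phi_lift_surj (forms_symmetrize ha) (fun i => refl_symmetrize i a).
    (* [iX (Phi_lift b)] is twice the lift of [iX b], so the preimage comes from 2b. *)
    exists (restrict (@sub_euclid R n T) (iX (fun p => 2 * b p + 0 * b p))).
      by exists (iX (fun p => 2 * b p + 0 * b p)) => //;
        exists (fun p => 2 * b p + 0 * b p) => //; exact: forms_comb.
    rewrite restrict_Phi -(restrict_symmetrize ev) -(iX_symmetrize ha) -ba.
    rewrite iX_Phi_lift; last exact: forms_multilinear hb.
    apply/funext => p; rewrite -[LHS]/(2 * restrict _ (Phi_lift (iX b)) p + 0 * _).
    by rewrite mul0r addr0.
split=> //.
  move=> _ [a ha <-]; rewrite /Phistar restrict_Phi; exists (Phi_lift a) => //.
  exact: smooth_forms_Phi_lift.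
Qed.
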